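(* The classes $\mathcal{BDG}$ and $\mathcal{PG}$ are closed under finite extensions. That is, if $G$ is a finitely generated group with a subgroup $H$ of finite index which is in $\mathcal{BDG}$ (respectively $\mathcal{PG}$), then $G$ is in $\mathcal{BDG}$ (respectively $\mathcal{PG}$).
   Context: For a group $G=\langle X;R\rangle$ with $X$ finite, let $\Sigma=X\cup X^{-1}$; the word problem of $G$ relative to this presentation is the language $\mathrm{WP}(G:X;R)=\{w\in\Sigma^*: w=1\text{ in }G\}$. $\mathcal{BDC}$ denotes the Boolean closure of the class of deterministic context-free languages: a language over a finite alphabet $\Sigma$ is in $\mathcal{BDC}$ if it belongs to the smallest family of subsets of $\Sigma^*$ containing the deterministic context-free languages over $\Sigma$ and closed under finite union, finite intersection and complement. $\mathcal{PCF}$ denotes the class of poly-context-free languages, i.e. intersections of finitely many context-free languages over the same alphabet. $\mathcal{BDG}$ (respectively $\mathcal{PG}$) is the class of finitely generated groups whose word problem is in $\mathcal{BDC}$ (respectively $\mathcal{PCF}$); this does not depend on the choice of presentation with finite generating set. *)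

(* Defs.v *)
From HB Require Import structures.
From Stdlib Require Export Relation_Operators.
From mathcomp Require Export all_boot all_classical.

Set Implicit Arguments.
Unset Strict Implicit.
Unset Printing Implicit Defensive.

Local Open Scope classical_set_scope.

Definition language (S : finType) := set (seq S).

(** * Context-free languages *)

Record cfg (S : finType) := CFG {
  cfg_nt : finType;
  cfg_start : cfg_nt;
  cfg_rules : seq (cfg_nt * seq (cfg_nt + S))
}.

Inductive cfg_step (S : finType) (g : cfg S) :
    seq (cfg_nt g + S) -> seq (cfg_nt g + S) -> Prop :=
| CfgStep (u v : seq (cfg_nt g + S)) (A : cfg_nt g) (r : seq (cfg_nt g + S)) :
    (A, r) \in cfg_rules g -> cfg_step (u ++ inl A :: v) (u ++ r ++ v).

Definition cfg_language (S : finType) (g : cfg S) : language S :=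
  [set w | clos_refl_trans _ (@cfg_step S g)
             [:: inl (cfg_start g)] [seq inr a | a <- w]].

Definition context_free (S : finType) (L : language S) : Prop :=
  exists g : cfg S, cfg_language g = L.

(** * Deterministic context-free languages *)

(** Deterministic pushdown automata accepting by final state, without end
    marker.  [dpda_trans q (Some a) Z] is the move that reads the letter [a] in
    state [q] with [Z] on top of the stack, [dpda_trans q None Z] the move that
    reads nothing; the string in the result replaces [Z], with its first symbol
    on top.  There is no move on the empty stack. *)
Record dpda (S : finType) := DPDA {
  dpda_state : finType;
  dpda_stack : finType;
  dpda_trans : dpda_state -> option S -> dpda_stack ->
               option (dpda_state * seq dpda_stack);
  dpda_init : dpda_state;
  dpda_bottom : dpda_stack;
  dpda_final : {set dpda_state};
  dpda_det : forall q Z, dpda_trans q None Z <> None ->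
               forall a, dpda_trans q (Some a) Z = None
}.

(** State, unread input, stack contents. *)
Definition dpda_config (S : finType) (M : dpda S) : Type :=
  (dpda_state M * seq S * seq (dpda_stack M))%type.

Inductive dpda_step (S : finType) (M : dpda S) :
    dpda_config M -> dpda_config M -> Prop :=
| DpdaRead q a w Z s q' r :
    dpda_trans q (Some a) Z = Some (q', r) ->
    dpda_step (q, a :: w, Z :: s) (q', w, r ++ s)
| DpdaSilent q w Z s q' r :
    dpda_trans q None Z = Some (q', r) ->
    dpda_step (q, w, Z :: s) (q', w, r ++ s).

Definition dpda_language (S : finType) (M : dpda S) : language S :=
  [set w | exists (q : dpda_state M) (s : seq (dpda_stack M)),
     q \in dpda_final M /\
     clos_refl_trans _ (@dpda_step S M)
       (dpda_init M, w, [:: dpda_bottom M]) (q, [::], s)].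

Definition det_context_free (S : finType) (L : language S) : Prop :=
  exists M : dpda S, dpda_language M = L.

(** * The classes BDC and PCF *)

(** Binary unions and intersections suffice: the empty ones are [L `&` ~` L]
    and [L `|` ~` L] for any deterministic context-free [L]. *)
Inductive BDC (S : finType) : language S -> Prop :=
| BDC_dcf L : det_context_free L -> BDC L
| BDC_union L K : BDC L -> BDC K -> BDC (L `|` K)
| BDC_inter L K : BDC L -> BDC K -> BDC (L `&` K)
| BDC_compl L : BDC L -> BDC (~` L).

Definition PCF (S : finType) (L : language S) : Prop :=
  exists (n : nat) (K : 'I_n.+1 -> language S),
    (forall i, context_free (K i)) /\ L = \bigcap_i K i.

(** * Word problems *)

Local Open Scope group_scope.

(** Words over [X] and formal inverses: [(x, false)] stands for [x] and
    [(x, true)] for its inverse. *)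
Definition letter_val (X : finType) (G : groupType) (f : X -> G)
    (a : X * bool) : G :=
  if a.2 then (f a.1)^-1 else f a.1.

Definition word_val (X : finType) (G : groupType) (f : X -> G)
    (w : seq (X * bool)) : G :=
  \prod_(a <- w) letter_val f a.

Definition generates (X : finType) (G : groupType) (f : X -> G) : Prop :=
  forall g : G, exists w, word_val f w = g.

(** The relators of a presentation [<X; R>] of [G] enter its word problem only
    through the map [f : X -> G]; conversely every generating [f] comes from a
    presentation, with all words of value 1 as relators. *)
Definition word_problem (X : finType) (G : groupType) (f : X -> G) :
    language (X * bool)%type :=
  [set w | word_val f w = 1].

Definition finitely_generated (G : groupType) : Prop :=
  exists (X : finType) (f : X -> G), generates f.

Definition BDG (G : groupType) : Prop :=
  exists (X : finType) (f : X -> G), generates f /\ BDC (word_problem f).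

Definition PG (G : groupType) : Prop :=
  exists (X : finType) (f : X -> G), generates f /\ PCF (word_problem f).

Definition finite_index (G : groupType) (H : {pred G}) : Prop :=
  finite_set (range (fun g : G => [set g * h | h in [set` H]])).

(* Main.v *)
(** Let [q] range over the right cosets of [H] in [G], with representatives
    [rep q].  Reading a letter [a] in state [q] moves to the coset [q'] of
    [rep q * a] and outputs a word over the generators of [H] for the Schreier
    element [rep q * a * (rep q')^-1].  A word over the generators of [G] is
    trivial iff this sequential transducer returns to its initial state and its
    output is trivial in [H].  Hence the word problem of [G] is the intersection
    of a regular language with the preimage of that of [H] under a sequential
    function.  Context-free languages are closed under all rational
    transductions; for deterministic pushdown automata the outputs are padded
    with [x x^-1] to be nonempty, which makes the simulation exact step by step
    (with empty outputs, silent moves of the simulated automaton after its last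
    letter would interfere with acceptance). *)

Require Import Defs.
From Stdlib Require Import Operators_Properties.

Set Implicit Arguments.
Unset Strict Implicit.
Unset Printing Implicit Defensive.

Local Open Scope classical_set_scope.

(** * Deterministic pushdown automata and sequential transducers *)

(** A run below is lifted step by step from its start. Here [h] will send a configuration of the
    simulating automaton to the one it simulates. *)
Lemma rt_functional_bisim (T U : Type) (RT : T -> T -> Prop)
    (RU : U -> U -> Prop) (h : T -> U) :
  (forall c d, RT c d -> RU (h c) (h d)) ->
  (forall c d, RU (h c) d -> exists2 d', RT c d' & h d' = d) ->
  forall c d, clos_refl_trans U RU (h c) d <->
    exists2 d', clos_refl_trans T RT c d' & h d' = d.
Proof.
move=> hfwd hbwd c d; split=> [|[d' cd' <-]]; last first.
  elim: cd' => {c d d'} [c d step|c|c d e _ cd _]; last exact: rt_trans.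
    by apply: rt_step; apply: hfwd.
  exact: rt_refl.
move=> run; have {run} := clos_rt_rt1n _ _ _ _ run.
move hc: (h c) => c0 cd; elim: cd c hc => {c0 d} [c0|c0 d0 e0 step _ IH] c hc.
  by exists c => //; exact: rt_refl.
move: step; rewrite -hc => /hbwd[d cd hd].
have [e de he] := IH d hd.
by exists e => //; apply: rt_trans de; exact: rt_step.
Qed.

(** [dpda_det] forbids reading wherever a silent move exists, so testing for a silent move decides
    the kind of step. *)
Lemma dpda_step_inv (S : finType) (M : dpda S) m w Z s d :
  @dpda_step S M (m, w, Z :: s) d ->
  if dpda_trans m None Z is Some (m', r) then d = (m', w, r ++ s)
  else exists b v m' r, [/\ w = b :: v, dpda_trans m (Some b) Z = Some (m', r)
    & d = (m', v, r ++ s)].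
Proof.
move Ec: (_, _, _) => c st.
case: st Ec => [m1 b v Z1 s1 m' r tr|m1 v Z1 s1 m' r tr] [-> -> -> ->].
  case E: dpda_trans => [x|]; last by exists b, v, m', r.
  have /dpda_det/(_ b) : dpda_trans m1 None Z1 <> None by rewrite E.
  by rewrite tr.
by rewrite tr.
Qed.

Section Gsm.

Variables (A B Q : finType) (delta : Q -> A -> Q) (out : Q -> A -> seq B).

Fixpoint gsm_out (q : Q) (w : seq A) : seq B :=
  if w is a :: w' then out q a ++ gsm_out (delta q a) w' else [::].

Definition out_bound : nat := \max_(p : Q * A) size (out p.1 p.2).

(** Output produced but not yet consumed; the length bound makes it finite, so that it fits into a
    state set. *)
Definition buffer : finType := out_bound.-bseq B.

Definition out_buffer (q : Q) (a : A) : buffer := insub_bseq _ (out q a).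

Lemma out_bufferE q a : out_buffer q a = out q a :> seq B.
Proof.
rewrite /out_buffer /insub_bseq val_insubd.
by rewrite (leq_bigmax (F := fun p : Q * A => size (out p.1 p.2)) (q, a)).
Qed.

Definition pop (u : buffer) : buffer := insub_bseq _ (behead u).

Lemma popE u : pop u = behead u :> seq B.
Proof.
rewrite /pop /insub_bseq val_insubd size_behead.
by rewrite (leq_trans (leq_pred _) (size_bseq u)).
Qed.

Section Dpda.

Variables (M : dpda B) (q0 : Q).

Let state : finType := (dpda_state M * Q * buffer)%type.

Let advance (m : dpda_state M) (q : Q) (u : buffer) (Z : dpda_stack M) :
    option (state * seq (dpda_stack M)) :=
  if dpda_trans m None Z is Some (m', r) then Some ((m', q, u), r)
  else if (u : seq B) is b :: _ then
    if dpda_trans m (Some b) Z is Some (m', r) then Some ((m', q, pop u), r)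
    else None
  else None.

(* The first output letter is consumed by the very move that reads [a], so that
   every move here corresponds to exactly one move of [M]. *)
Let trans (p : state) (oa : option A) (Z : dpda_stack M) :=
  let: (m, q, u) := p in
  if oa is Some a then
    if (u == [::] :> seq B) && (dpda_trans m None Z == None)
    then advance m (delta q a) (out_buffer q a) Z else None
  else advance m q u Z.

(** A letter is read only when the buffer is empty and [M] has no silent move, and then [advance] on
    that buffer is undefined. *)
Let trans_det p Z : trans p None Z <> None -> forall a, trans p (Some a) Z = None.
Proof.
case: p => [[m q] u] /= + a; rewrite /advance.
case: eqP => //= u0; case: eqP => //= ->.
by rewrite /= u0.
Qed.

Definition gsm_dpda : dpda A :=
  @DPDA A state (dpda_stack M) trans (dpda_init M, q0, [bseq])
    (dpda_bottom M)
    [set p : state | (p.1.1 \in dpda_final M) && (p.2 == [::] :> seq B)]%SET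
    trans_det.

Let image (c : dpda_config gsm_dpda) : dpda_config M :=
  (c.1.1.1.1, c.1.1.2 ++ gsm_out c.1.1.1.2 c.1.2, c.2).

Let advance_sound m q u Z p r :
  advance m q u Z = Some (p, r) -> p.1.2 = q /\ forall w s,
    dpda_step (m, (u : seq B) ++ w, Z :: s) (p.1.1, (p.2 : seq B) ++ w, r ++ s).
Proof.
rewrite /advance; case E: dpda_trans => [[m' r']|].
  by move=> [<- <-]; split=> // w s; apply: DpdaSilent.
case Eu: (u : seq B) => [|b v] //; case E': dpda_trans => [[m' r']|] // [<- <-].
split=> //= w s; rewrite popE Eu /=; exact: DpdaRead.
Qed.

Let image_step c d : dpda_step c d -> dpda_step (image c) (image d).
Proof.
case=> [[[m q] u] a w Z s p r|[[m q] u] w Z s p r] /=.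
  case: eqP => //= u0; case: eqP => //= _ /advance_sound[].
  by rewrite /image /= u0 out_bufferE => ->; apply.
by move=> /advance_sound[]; rewrite /image /= => ->; apply.
Qed.

Hypothesis out_neq0 : forall q a, out q a != [::].

Let gsm_out_eq0 q w : gsm_out q w = [::] -> w = [::].
Proof. by case: w => [|a w] //=; have := out_neq0 q a; case: (out q a). Qed.

Let image_step_inv c d : dpda_step (image c) d ->
  exists2 d', dpda_step c d' & image d' = d.
Proof.
move: c => [[[[m q] u] w] [|Z s]]; rewrite /image /=.
  by move=> st; inversion st.
move/dpda_step_inv; case E: dpda_trans => [[m' r]|].
  move=> ->; exists ((m', q, u), w, r ++ s) => //.
  by apply: DpdaSilent; rewrite /= /advance E.
move=> [b [v [m' [r [+ tr ->]]]]]; case Eu: (u : seq B) => [|b' u'] /=.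
  (* The buffer is empty, so [b] comes from the output on the next letter [a]. That output is
     nonempty, hence starts with [b], and the move reading [a] consumes it at once. *)
  case: w => [//|a w] /= Ew.
  have Eo : out_buffer q a = b :: behead (out q a) :> seq B.
    rewrite out_bufferE; case: (out q a) (out_neq0 q a) Ew => //= b1 o _.
    by case=> ->.
  exists ((m', delta q a, pop (out_buffer q a)), w, r ++ s).
    by apply: DpdaRead => /=; rewrite Eu E /advance E Eo tr.
  rewrite /= popE Eo /=; move: Ew Eo; rewrite out_bufferE.
  by move=> + Eo; rewrite Eo => -[->].
move=> [Eb Ev]; subst b'; exists ((m', q, pop u), w, r ++ s).
  by apply: DpdaSilent; rewrite /= /advance E Eu tr.
by rewrite /= popE Eu -Ev.
Qed.

Lemma gsm_dpda_language :
  dpda_language gsm_dpda = [set w | dpda_language M (gsm_out q0 w)].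
Proof.
apply/seteqP; split=> w.
  move=> [[[m q] u] [s []]]; rewrite inE /= => /andP[mF /eqP u0] run.
  exists m, s; split=> //.
  have := (rt_functional_bisim image_step image_step_inv
    (dpda_init M, q0, [bseq], w, [:: dpda_bottom M]) (image (m, q, u, [::], s))).2.
  by rewrite /image /= u0; apply; exists (m, q, u, [::], s) => //=; rewrite u0.
move=> [m [s [mF]]] run.
have := (rt_functional_bisim image_step image_step_inv
    (dpda_init M, q0, [bseq], w, [:: dpda_bottom M]) (m, [::], s)).1.
rewrite /image /= => /(_ run)[[[[[m' q] u] w'] s'] run' /= [Em Ew Es]].
subst m' s'.
(* [M] has exhausted its input: the buffer is empty and, as no output is empty, so is the unread
   word. *)
have u0 : u = [::] :> seq B by case: (u : seq B) Ew.
rewrite u0 in Ew; have w0 := gsm_out_eq0 Ew; subst w'.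
by exists (m, q, u), s; rewrite inE /= mF u0.
Qed.

End Dpda.

Hypothesis out_neq0 : forall q a, out q a != [::].

Lemma det_context_free_gsm_preimage (q0 : Q) (L : language B) :
  det_context_free L -> det_context_free [set w | L (gsm_out q0 w)].
Proof. by move=> [M <-]; exists (gsm_dpda M q0); apply: gsm_dpda_language. Qed.

(** Taking preimages commutes with the Boolean operations. *)
Lemma BDC_gsm_preimage (q0 : Q) (L : language B) :
  BDC L -> BDC [set w | L (gsm_out q0 w)].
Proof.
elim=> [K /(det_context_free_gsm_preimage q0)|K K' _ IH _ IH'|K K' _ IH _ IH'
  |K _ IH].
- exact: BDC_dcf.
- exact: BDC_union IH IH'.
- exact: BDC_inter IH IH'.
- exact: BDC_compl IH.
Qed.

End Gsm.

Lemma det_context_free_dfa (A Q : finType) (delta : Q -> A -> Q) (q0 : Q)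
    (F : {set Q}) :
  det_context_free [set w | foldl delta q0 w \in F].
Proof.
(* The only stack symbol is put back at every move, because an empty stack would block the
   automaton. *)
pose trans (q : Q) (oa : option A) (Z : unit) :=
  omap (fun a => (delta q a, [:: Z])) oa.
have trans_det q Z : trans q None Z <> None -> forall a, trans q (Some a) Z = None.
  by [].
pose M := @DPDA A Q unit trans q0 tt F trans_det.
exists M; apply/seteqP; split=> w.
  move=> [q [s [qF run]]] /=.
  suff -> : foldl delta q0 w = q by [].
  have inv c d : clos_refl_trans _ (@dpda_step A M) c d ->
      foldl delta c.1.1 c.1.2 = foldl delta d.1.1 d.1.2.
    elim=> {c d} [c d|//|c d e _ -> _ -> //].
    by case=> [q1 a v Z t q2 r|q1 v Z t q2 r] //= [<- _].
  exact: (inv _ _ run).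
move=> /= wF; exists (foldl delta q0 w), [:: tt]; split=> //.
suff run v q : clos_refl_trans _ (@dpda_step A M)
    (q, v, [:: tt]) (foldl delta q v, [::], [:: tt]) by exact: run.
elim: v q => [|a v IH] q /=; first exact: rt_refl.
apply: rt_trans _ (IH (delta q a)); apply: rt_step.
exact: (@DpdaRead A M q a v tt [::] _ [:: tt]).
Qed.

(** * Context-free grammars and rational transductions *)

(** Derivation forests: each symbol yields its own factor of the word, so inductions follow the
    grammar and not the order of rewriting. *)
Inductive derives (S : finType) (g : cfg S) :
    seq (cfg_nt g + S) -> seq S -> Prop :=
| DerivesNil : derives [::] [::]
| DerivesLetter a s w : derives s w -> derives (inr a :: s) (a :: w)
| DerivesNt X r s u v : (X, r) \in cfg_rules g -> derives r u ->
    derives s v -> derives (inl X :: s) (u ++ v).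

Section Derives.

Variables (S : finType) (g : cfg S).
Implicit Types (s r : seq (cfg_nt g + S)) (w : seq S).

Lemma derives_letters w : derives (map inr w : seq (cfg_nt g + S)) w.
Proof. by elim: w => [|a w IH] /=; constructor. Qed.

Lemma derives_cat s1 s2 w : derives (s1 ++ s2) w <->
  exists w1 w2, [/\ w = w1 ++ w2, derives s1 w1 & derives s2 w2].
Proof.
split=> [|[w1 [w2 [-> d1 d2]]]]; last first.
  elim: d1 => //= [a s w' _|X r s u v rule dr _ _ IH]; first exact: DerivesLetter.
  by rewrite -catA; apply: DerivesNt rule dr IH.
elim: s1 w => [|[X|a] s1 IH] w /=.
- by exists [::], w; split=> //; constructor.
- move Es: (inl X :: _) => s d; case: d Es => // X' r s' u v rule dr dv [EX Es].
  subst X' s'; have [w1 [w2 [-> d1 d2]]] := IH v dv.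
  by exists (u ++ w1), w2; split=> //; rewrite ?catA //; apply: DerivesNt rule dr d1.
- move Es: (inr a :: _) => s d; case: d Es => // a' s' v dv [Ea Es].
  subst a' s'; have [w1 [w2 [-> d1 d2]]] := IH v dv.
  by exists (a :: w1), w2; split=> //; apply: DerivesLetter.
Qed.

Lemma derivesP s w :
  derives s w <-> clos_refl_trans _ (@cfg_step S g) s (map inr w).
Proof.
split=> [|run].
  have ctx s1 s2 t t' : clos_refl_trans _ (@cfg_step S g) t t' ->
      clos_refl_trans _ (@cfg_step S g) (s1 ++ t ++ s2) (s1 ++ t' ++ s2).
    elim=> {t t'} [t t' [u v X r rule]|t|t t' t'' _ ? _]; last exact: rt_trans.
      apply: rt_step; have := CfgStep (s1 ++ u) (v ++ s2) rule.
      by rewrite -!catA.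
    exact: rt_refl.
  elim=> {s w} [|a s w _ IH|X r s u v rule _ IHr _ IHs] /=.
  - exact: rt_refl.
  - by have := ctx [:: inr a] [::] _ _ IH; rewrite /= !cats0.
  - apply: (rt_trans _ _ _ (r ++ s)).
      by apply: rt_step; exact: (CfgStep [::] s rule).
    rewrite map_cat; apply: (rt_trans _ _ _ (map inr u ++ s)).
      exact: (ctx [::] s).
    by have := ctx (map inr u) [::] _ _ IHs; rewrite /= !cats0.
have {run} := clos_rt_rt1n _ _ _ _ run.
move Et: (map inr w) => t run; elim: run Et => {s t} [t <-|s s' t st _ IH Et].
  exact: derives_letters.
(* One rewriting step is undone: the factor derived from [r] becomes the factor of [X]. *)
case: st (IH Et) => u v X r rule.
move/derives_cat => [w1 [w2 [-> d1 /derives_cat[w3 [w4 [-> d3 d4]]]]]].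
apply/derives_cat; exists w1, (w3 ++ w4); split=> //.
exact: DerivesNt rule d3 d4.
Qed.

End Derives.

(** * Triple construction for rational transductions *)

Section Transduction.

Variables (A B P : finType) (rd : P -> A -> P -> bool) (em : P -> B -> P -> bool).

Inductive run : P -> seq A -> seq B -> P -> Prop :=
| RunNil p : run p [::] [::] p
| RunRead p a p1 w v p2 :
    rd p a p1 -> run p1 w v p2 -> run p (a :: w) v p2
| RunEmit p b p1 w v p2 :
    em p b p1 -> run p1 w v p2 -> run p w (b :: v) p2.

Lemma run_cat p w v p1 w' v' p2 :
  run p w v p1 -> run p1 w' v' p2 -> run p (w ++ w') (v ++ v') p2.
Proof.
elim=> {p w v p1} // [p a p1 w v p3 tr _ IH|p b p1 w v p3 tr _ IH] /IH.
  exact: RunRead.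
exact: RunEmit.
Qed.

Variables (g : cfg B) (p0 : P) (fin : pred P).

(* [Some (p, inl X, p')] generates the inputs of the runs from [p] to [p'] whose
   output is derived from [X]; [Some (p, inr (Some b), p')] those of the runs
   whose only output is a final [b]; [Some (p, inr None, p)] those of the runs
   without output from [p] to a state in [fin]. *)
Let nt : finType := option (P * (cfg_nt g + option B) * P).

Let slot (X : cfg_nt g + B) : cfg_nt g + option B :=
  match X with inl X => inl X | inr b => inr (Some b) end.

(** The states between consecutive symbols are guessed, as in the Bar-Hillel construction for
    intersection with a regular language. *)
Fixpoint interleave (p : P) (s : seq (cfg_nt g + B)) (p' : P) :
    seq (seq (nt + A)) :=
  if s is X :: s' then
    [seq inl (Some (p, slot X, p1)) :: t | p1 <- enum P, t <- interleave p1 s' p']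
  else if p == p' then [:: [::]] else [::].

Definition start_rules : seq (nt * seq (nt + A)) :=
  [seq (None, [:: inl (Some (p0, inl (cfg_start g), p));
                  inl (Some (p, inr None, p))]) | p <- enum P].

Definition read_rules : seq (nt * seq (nt + A)) :=
  [seq (let: (p, a, p1, o, p') := x in
        (Some (p, inr o, p'), [:: inr a; inl (Some (p1, inr o, p'))]))
    | x <- enum {: P * A * P * option B * P} &
      let: (p, a, p1, _, _) := x in rd p a p1].

Definition end_rules : seq (nt * seq (nt + A)) :=
  [seq (let: (p, o, p') := x in (Some (p, inr o, p'), [::]))
    | x <- enum {: P * option B * P} &
      let: (p, o, p') := x in if o is Some b then em p b p' else fin p].

Definition nt_rules : seq (nt * seq (nt + A)) :=
  flatten [seq [seq (Some (x.1, inl rule.1, x.2), t)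
      | x <- enum {: P * P}, t <- interleave x.1 rule.2 x.2]
    | rule <- cfg_rules g].

Definition transduction_cfg : cfg A :=
  @CFG A nt None (start_rules ++ read_rules ++ end_rules ++ nt_rules).

Inductive transduction_rule : nt -> seq (nt + A) -> Prop :=
| StartRule p : transduction_rule None
    [:: inl (Some (p0, inl (cfg_start g), p)); inl (Some (p, inr None, p))]
| ReadRule p a p1 o p' : rd p a p1 -> transduction_rule (Some (p, inr o, p'))
    [:: inr a; inl (Some (p1, inr o, p'))]
| EmitRule p b p' : em p b p' ->
    transduction_rule (Some (p, inr (Some b), p')) [::]
| FinRule p p' : fin p -> transduction_rule (Some (p, inr None, p')) [::]
| NtRule p X r p' t : (X, r) \in cfg_rules g -> t \in interleave p r p' ->
    transduction_rule (Some (p, inl X, p')) t.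

Lemma transduction_ruleP N t :
  (N, t) \in cfg_rules transduction_cfg <-> transduction_rule N t.
Proof.
rewrite /transduction_cfg /= !mem_cat; split.
  case/or4P.
  - by case/mapP=> p _ [-> ->]; constructor.
  - case/mapP=> -[[[[p a] p1] o] p']; rewrite mem_filter => /andP[tr _] [-> ->].
    exact: ReadRule.
  - case/mapP=> -[[p [b|]] p']; rewrite mem_filter => /andP[tr _] [-> ->].
      exact: EmitRule.
    exact: FinRule.
  - case/flatten_mapP=> -[X r] rule /allpairsPdep[[p p'] [t' [_ tr [-> ->]]]].
    exact: NtRule rule tr.
case=> [p|p a p1 o p' tr|p b p' tr|p p' tr|p X r p' t' rule tr].
- by rewrite (map_f _ (x := p)) ?mem_enum.
- apply/or4P/Or42/mapP; exists (p, a, p1, o, p') => //.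
  by rewrite mem_filter tr mem_enum.
- apply/or4P/Or43/mapP; exists (p, Some b, p') => //.
  by rewrite mem_filter tr mem_enum.
- apply/or4P/Or43/mapP; exists (p, None, p') => //.
  by rewrite mem_filter tr mem_enum.
- apply/or4P/Or44/flatten_mapP; exists (X, r) => //.
  by apply/allpairsPdep; exists (p, p'), t'; split=> //; rewrite mem_enum.
Qed.

(** The inverse image of [L] under the relation that the transducer realizes. *)
Definition transduction (L : language B) : language A :=
  [set w | exists p v, [/\ fin p, run p0 w v p & L v]].

(** For [inr None] the last component is a mere tag, carried along so that one form of reading rule
    serves both kinds of [inr] triples. *)
Let nt_sound (N : nt) (w : seq A) : Prop :=
  match N with
  | None => transduction (cfg_language g) w
  | Some (p, inl X, p') => exists2 v, derives [:: inl X] v & run p w v p'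
  | Some (p, inr (Some b), p') => run p w [:: b] p'
  | Some (p, inr None, _) => exists2 p', fin p' & run p w [::] p'
  end.

Fixpoint form_sound (s : seq (nt + A)) (w : seq A) : Prop :=
  match s with
  | [::] => w = [::]
  | inr a :: s' => exists2 w', w = a :: w' & form_sound s' w'
  | inl N :: s' => exists w1 w2, [/\ w = w1 ++ w2, nt_sound N w1 & form_sound s' w2]
  end.

Let interleave_sound p s p' t w : t \in interleave p s p' -> form_sound t w ->
  exists2 v, derives s v & run p w v p'.
Proof.
elim: s p t w => [|X s IH] p t w /=.
  case: eqP => // <-; rewrite inE => /eqP -> /= ->.
  by exists [::]; constructor.
move=> /allpairsPdep[p1 [t' [_ /IH{}IH ->]]] /= [w1 [w2 [-> st /IH[v2 d2 r2]]]].
case: X st => [X|b] /= st.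
  have [v1 d1 r1] := st.
  exists (v1 ++ v2); last exact: run_cat r1 r2.
  by apply/(derives_cat [:: inl X]); exists v1, v2.
exists (b :: v2); first exact: DerivesLetter.
exact: (run_cat st r2).
Qed.

Let derives_sound s w : @derives A transduction_cfg s w -> form_sound s w.
Proof.
elim=> {s w} [//|a s w _ IH|N r s u v /transduction_ruleP rule _ IHr _ IHs] /=.
  by exists w.
exists u, v; split=> //.
case: rule IHr => [p|p a p1 o p' tr|p b p' tr|p p' tr|p X r' p' t' rule tr] /=.
- move=> [w1 [w2 [-> [v1 d1 r1] [w3 [w4 [-> [p2 fp r2] ->]]]]]].
  exists p2, v1; split=> //; last by apply/derivesP.
  by rewrite cats0 -[v1]cats0; apply: run_cat r1 r2.
- move=> [w1 -> [w2 [w3 [-> st ->]]]]; rewrite cats0.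
  case: o st => [b|]; first exact: RunRead.
  by move=> [p2 fp st]; exists p2 => //; apply: RunRead st.
- by move=> ->; apply: RunEmit tr (RunNil _).
- by move=> ->; exists p => //; exact: RunNil.
- move=> /(interleave_sound tr)[v' d' r1]; exists v' => //.
  by rewrite -[v']cats0; apply: DerivesNt rule d' (DerivesNil _).
Qed.

(** The run is cut right after [b] is emitted; until then it only reads, which reading rules closed
    by an emitting rule reproduce. *)
Let run_first p w b v p' : run p w (b :: v) p' ->
  exists w1 w2 p1, [/\ w = w1 ++ w2, run p1 w2 v p' &
    @derives A transduction_cfg [:: inl (Some (p, inr (Some b), p1))] w1].
Proof.
move Ev: (b :: v) => v' st; elim: st Ev => {p w v' p'} //
  [p a p1 w v' p2 tr _ IH /IH|p b' p1 w v' p2 tr st _ [Eb Ev]].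
  move=> [w1 [w2 [p3 [-> st d]]]]; exists (a :: w1), w2, p3; split=> //.
  rewrite -[a :: w1]cats0; apply: (DerivesNt (g := transduction_cfg)
    (r := [:: inr a; inl (Some (p1, inr (Some b), p3))])) (DerivesNil _).
    by apply/transduction_ruleP; exact: ReadRule.
  exact: DerivesLetter.
subst b' v'; exists [::], w, p1; split=> //.
apply: (DerivesNt (g := transduction_cfg) (r := [::]) (u := [::]))
  (DerivesNil _) (DerivesNil _).
by apply/transduction_ruleP; exact: EmitRule.
Qed.

Let run_last p p1 w p' : run p w [::] p' -> fin p' ->
  @derives A transduction_cfg [:: inl (Some (p, inr None, p1))] w.
Proof.
move Ev: [::] => v st; elim: st Ev => {p w v p'} //
  [p _ fp|p a p2 w v p' tr _ IH Ev fp].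
  apply: (DerivesNt (g := transduction_cfg) (r := [::]) (u := [::]))
    (DerivesNil _) (DerivesNil _).
  by apply/transduction_ruleP; exact: FinRule.
rewrite -[a :: w]cats0; apply: (DerivesNt (g := transduction_cfg)
    (r := [:: inr a; inl (Some (p2, inr None, p1))])) (DerivesNil _).
  by apply/transduction_ruleP; exact: ReadRule.
by apply: DerivesLetter; exact: IH.
Qed.

(** The surplus output [v'] drives the induction: the run is cut once the output of one symbol is
    complete, and its remainder serves the next symbols. *)
Let interleave_complete s v : @derives B g s v ->
  forall p w v' p', run p w (v ++ v') p' ->
  exists t w1 w2 p1, [/\ w = w1 ++ w2, run p1 w2 v' p',
    t \in interleave p s p1 & @derives A transduction_cfg t w1].
Proof.
elim=> {s v} [|b s v _ IH|X r s u v rule _ IHr _ IHs] p w v' p' /=.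
- move=> st; exists [::], [::], w, p; split=> //; first by rewrite eqxx inE.
  exact: DerivesNil.
- move/run_first=> [w1 [w2 [p1 [-> /IH[t [w3 [w4 [p2 [-> st tin dt]]]]] d]]]].
  exists (inl (Some (p, inr (Some b), p1)) :: t), (w1 ++ w3), w4, p2.
  split=> //; first by rewrite catA.
    by apply/allpairsPdep; exists p1, t; split=> //; rewrite mem_enum.
  by apply/(derives_cat (g := transduction_cfg) [:: _]); exists w1, w3.
- rewrite -catA => /IHr[t [w1 [w2 [p1 [-> /IHs + tin1 dt1]]]]].
  move=> [t' [w3 [w4 [p2 [-> st tin dt]]]]].
  exists (inl (Some (p, inl X, p1)) :: t'), (w1 ++ w3), w4, p2.
  split=> //; first by rewrite catA.
    by apply/allpairsPdep; exists p1, t'; split=> //; rewrite mem_enum.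
  apply: (DerivesNt (g := transduction_cfg)) dt1 dt.
  by apply/transduction_ruleP; exact: NtRule rule tin1.
Qed.

Lemma transduction_cfg_language :
  cfg_language transduction_cfg = transduction (cfg_language g).
Proof.
apply/seteqP; split=> w.
  by move/derivesP/derives_sound=> /= [w1 [w2 [-> H ->]]]; rewrite cats0.
move=> [p [v [fp st /derivesP d]]]; apply/derivesP.
(* With empty surplus, [w2] is read without output and falls to the second nonterminal of the start
   rule. *)
rewrite -[v]cats0 in st.
have [t [w1 [w2 [p1 [-> st2 tin dt]]]]] := interleave_complete d st.
rewrite -[w1 ++ w2]cats0; apply: (DerivesNt (g := transduction_cfg)) (DerivesNil _).
  by apply/transduction_ruleP; exact: (StartRule p1).
apply/(derives_cat (g := transduction_cfg) [:: _]); exists w1, w2; split=> //.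
  move: tin => /= /allpairsPdep[p2 [t' [_ + Et]]]; subst t.
  by case: eqP => // <-; rewrite inE => /eqP Et'; move: dt; rewrite Et'.
exact: run_last st2 fp.
Qed.

End Transduction.

Lemma context_free_transduction (A B P : finType) (rd : P -> A -> P -> bool)
    (em : P -> B -> P -> bool) (p0 : P) (fin : pred P) (L : language B) :
  context_free L -> context_free (transduction rd em p0 fin L).
Proof.
move=> [g <-]; exists (transduction_cfg rd em g p0 fin).
exact: transduction_cfg_language.
Qed.

(** * Sequential transducers as rational transductions *)

Section GsmContextFree.

Variables (A B Q : finType) (delta : Q -> A -> Q) (out : Q -> A -> seq B).
Variables (F : {set Q}).

Let state : finType := (Q * buffer out)%type.

(** A move emits a single letter, so the output on a letter waits in the buffer and is flushed
    before the next letter is read. *)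
Let rd (p : state) (a : A) (p' : state) :=
  (p.2 == [::] :> seq B) && (p' == (delta p.1 a, out_buffer out p.1 a)).

Let em (p : state) (b : B) (p' : state) :=
  (p'.1 == p.1) && (p.2 == b :: p'.2 :> seq B).

Let fin : pred state := [pred p : state | (p.1 \in F) && (p.2 == [::] :> seq B)].

Let run_sound p w v p' : run rd em p w v p' ->
  p'.1 = foldl delta p.1 w /\
  (p.2 : seq B) ++ gsm_out delta out p.1 w = v ++ (p'.2 : seq B).
Proof.
elim=> {p w v p'} [p|p a p1 w v p2 /andP[/eqP Eu /eqP Ep1] _ [-> <-]
  |p b p1 w v p2 /andP[/eqP Eq /eqP Eu] _ [-> IH]] /=.
- by rewrite cats0.
- by rewrite Ep1 Eu /= out_bufferE.
- by rewrite -IH Eu Eq.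
Qed.

Let run_flush q (u : buffer out) w v p :
  run rd em (q, [bseq]) w v p -> run rd em (q, u) w ((u : seq B) ++ v) p.
Proof.
move=> st; have [s Es] : exists s, u = s :> seq B by exists u.
elim: s u Es => [|b s IH] u Es.
  by rewrite (_ : u = [bseq]) //; apply: val_inj.
have Ep := popE u; rewrite Es /= in Ep.
rewrite Es /= -Ep; apply: RunEmit (IH (pop u) Ep).
by apply/andP; split=> //; apply/eqP; rewrite /= Ep.
Qed.

Let run_complete q w :
  run rd em (q, [bseq]) w (gsm_out delta out q w) (foldl delta q w, [bseq]).
Proof.
elim: w q => [|a w IH] q /=; first exact: RunNil.
rewrite -(out_bufferE out q a); apply: RunRead (run_flush _ (IH _)).
by rewrite /rd /= !eqxx.
Qed.

(** The regular condition is absorbed into the final states, so it costs no separate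
    intersection. *)
Lemma context_free_gsm_preimage (q0 : Q) (L : language B) : context_free L ->
  context_free [set w | foldl delta q0 w \in F /\ L (gsm_out delta out q0 w)].
Proof.
move=> /(context_free_transduction rd em (q0, [bseq]) fin).
congr context_free; apply/seteqP; split=> w.
  move=> [p [v [/andP[pF /eqP u0] /run_sound /= [Eq Ev] Lv]]].
  by rewrite -Eq Ev u0 cats0.
move=> [wF Lw]; exists (foldl delta q0 w, [bseq]), (gsm_out delta out q0 w).
by split=> //; rewrite /fin inE /= wF.
Qed.

Lemma PCF_gsm_preimage (q0 : Q) (L : language B) : PCF L ->
  PCF [set w | foldl delta q0 w \in F /\ L (gsm_out delta out q0 w)].
Proof.
move=> [n [K [Kcf ->]]].
exists n, (fun i =>
  [set w | foldl delta q0 w \in F /\ K i (gsm_out delta out q0 w)]).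
split=> [i|]; first exact: context_free_gsm_preimage.
apply/seteqP; split=> w /=; first by move=> [wF wK] i _; split=> //; exact: wK.
(* The family is indexed by ['I_n.+1], so a member [ord0] is there to supply the regular
   condition. *)
by move=> h; split=> [|i _]; [case: (h ord0) | case: (h i)].
Qed.

End GsmContextFree.

(** * Schreier rewriting *)

Local Open Scope group_scope.

(* [cos] is the projection to the right cosets of [P], encoded through the left
   coset [g^-1 P] of the inverse. *)
Lemma right_coset_map (G : groupType) (P : {pred G}) (H : subGroupType P) :
  finite_index P ->
  exists (Q : finType) (cos : G -> Q),
    forall g g', cos g = cos g' <-> g * g'^-1 \in P.
Proof.
(* The closure properties of [P] are read off from the group structure of [H]. *)
have P1 : 1 \in P by have := valP (1 : H); rewrite val1.
have PM x y : x \in P -> y \in P -> x * y \in P.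
  by move=> xP yP; have := valP (Sub x xP * Sub y yP : H); rewrite valM !SubK.
have PV x : x \in P -> x^-1 \in P.
  by move=> xP; have := valP ((Sub x xP : H)^-1); rewrite gmulfV /= SubK.
rewrite /finite_index => /finite_seqP[s sE].
pose coset (g : G) : set G := [set g^-1 * h | h in [set` P]]%classic.
have sP g : coset g \in s.
  by have : [set` s]%classic (coset g) by rewrite -sE; exists g^-1.
exists (seq_sub s), (fun g => SeqSub (sP g)) => g g'; split.
  move=> /(congr1 val) /= E.
  have : coset g g^-1 by exists 1 => //; rewrite mulg1.
  rewrite E => -[h hP Eh].
  by rewrite -[g * _]invgF PV // -Eh mulgA mulgV mul1g.
move=> gP; apply/val_inj/seteqP => /=; split=> _ [h hP <-].
  exists (g' * g^-1 * h); last by rewrite !mulgA mulVg mul1g.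
  by apply: PM => //; rewrite -invgF PV.
by exists (g * g'^-1 * h); [exact: PM | rewrite !mulgA mulVg mul1g].
Qed.

Lemma word_val_cat (X : finType) (G : groupType) (f : X -> G)
    (u v : seq (X * bool)) :
  word_val f (u ++ v) = word_val f u * word_val f v.
Proof. by rewrite /word_val big_cat. Qed.

Lemma word_val_cons (X : finType) (G : groupType) (f : X -> G) a v :
  word_val f (a :: v) = letter_val f a * word_val f v.
Proof. by rewrite /word_val big_cons. Qed.

Lemma generates_nonempty (X : finType) (G : groupType) (f : X -> G) (x : X) :
  generates f -> forall g, exists2 w, w != [::] & word_val f w = g.
Proof.
move=> gen g; have [w <-] := gen g.
exists [:: (x, false), (x, true) & w] => //.
by rewrite !word_val_cons /letter_val /= mulVKg.
Qed.

Section Schreier.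

Variables (G : groupType) (P : {pred G}) (H : subGroupType P).
Variables (X : finType) (f : X -> H) (Y : finType) (k : Y -> G).
Variables (Q : finType) (cos : G -> Q).
Hypothesis cosP : forall g g', cos g = cos g' <-> g * g'^-1 \in P.

(** The default 1 is taken only at states outside the image of [cos]. *)
Let rep (q : Q) : G := xget 1 [set g | cos g = q]%classic.

Let cosK g : cos (rep (cos g)) = cos g.
Proof. by rewrite /rep; case: xgetP => [h _ <-//|/(_ g)/=]. Qed.

Definition coset_step (q : Q) (a : Y * bool) : Q := cos (rep q * letter_val k a).

Definition schreier (q : Q) (a : Y * bool) : G :=
  rep q * letter_val k a * (rep (coset_step q a))^-1.

Lemma schreier_mem q a : schreier q a \in P.
Proof. by apply/cosP; rewrite cosK. Qed.

Lemma coset_stepE g a : coset_step (cos g) a = cos (g * letter_val k a).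
Proof.
apply/cosP; rewrite invgM mulgA mulgK.
by apply/cosP; rewrite cosK.
Qed.

Lemma foldl_coset_step g w : foldl coset_step (cos g) w = cos (g * word_val k w).
Proof.
elim: w g => [|a w IH] g /=; first by rewrite /word_val big_nil mulg1.
by rewrite coset_stepE IH word_val_cons mulgA.
Qed.

Variable out : Q -> Y * bool -> seq (X * bool).
Hypothesis outP : forall q a, val (word_val f (out q a)) = schreier q a.

(** The product of Schreier elements telescopes: inner representatives cancel. *)
Lemma word_val_gsm_out q w :
  val (word_val f (gsm_out coset_step out q w)) =
  rep q * word_val k w * (rep (foldl coset_step q w))^-1.
Proof.
elim: w q => [|a w IH] q /=.
  by rewrite /word_val !big_nil val1 mulg1 mulgV.
by rewrite word_val_cat valM IH outP word_val_cons /schreier !mulgA mulgVK.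
Qed.

(** The representative of the trivial coset need not be 1, so on words returning to that coset the
    output represents a conjugate of the input, which is trivial exactly when the input is. *)
Lemma word_problem_schreier :
  word_problem k = [set w | foldl coset_step (cos 1) w = cos 1 /\
    word_problem f (gsm_out coset_step out (cos 1) w)]%classic.
Proof.
apply/seteqP; split=> w; rewrite /word_problem /=.
  move=> w1; rewrite foldl_coset_step mul1g w1; split=> //; apply: val_inj.
  by rewrite word_val_gsm_out foldl_coset_step mul1g w1 mulg1 val1 mulgV.
move=> [Ew /(congr1 val)]; rewrite word_val_gsm_out Ew val1 => /(canRL (mulgVK _)).
by rewrite mul1g -[RHS]mulg1 => /mulgI.
Qed.

End Schreier.

Theorem theorem3p5 (G : groupType) (P : {pred G}) (H : subGroupType P) :
  finitely_generated G -> finite_index P ->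
  (BDG H -> BDG G) /\ (PG H -> PG G).
Proof.
move=> [Y [k kgen]] /(right_coset_map H)[Q [cos cosP]].
(* [C] constrains the output words: nonempty for the pushdown simulation, arbitrary otherwise. *)
have outE (X : finType) (f : X -> H) (C : pred (seq (X * bool))) :
    (forall h, exists2 w, C w & word_val f w = h) ->
  exists out : Q -> Y * bool -> seq (X * bool),
    forall q a, C (out q a) /\ val (word_val f (out q a)) = schreier k cos q a.
  move=> gen.
  suff /choice[out outP] : forall x : Q * (Y * bool), exists w,
      C w /\ val (word_val f w) = schreier k cos x.1 x.2.
    by exists (fun q a => out (q, a)) => q a; exact: outP (q, a).
  move=> [q a]; have [w Cw wE] :=
    gen (Sub (schreier k cos q a) (schreier_mem k cosP q a)).
  by exists w; split=> //; rewrite wE SubK.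
have wp_regular (F : {set Q}) :
    BDC [set w | foldl (coset_step k cos) (cos 1) w \in F]%classic.
  by apply: BDC_dcf; exact: det_context_free_dfa.
have gen_predT (X : finType) (f : X -> H) : generates f ->
    forall h, exists2 w, predT w & word_val f w = h.
  by move=> fgen h; have [w <-] := fgen h; exists w.
split=> [[X [f [fgen fL]]]|[X [f [fgen fL]]]]; exists Y, k; split=> //.
  (* Padding outputs requires a generator [x] of [H]. *)
  have [x _|X0] := pickP (@predT X).
    have [out outP] := outE _ _ (fun w => w != [::]) (generates_nonempty x fgen).
    rewrite (word_problem_schreier cosP (fun q a => (outP q a).2)).
    have := BDC_inter (wp_regular [set cos 1]%SET)
      (BDC_gsm_preimage (coset_step k cos) (fun q a => (outP q a).1) (cos 1) fL).
    by congr BDC; apply/seteqP; split=> w /=; rewrite inE => -[/eqP].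
  (* Over an empty alphabet every output is the empty word, so only the regular condition
     remains. *)
  have [out outP] := outE _ _ predT (gen_predT _ _ fgen).
  rewrite (word_problem_schreier cosP (fun q a => (outP q a).2)).
  have := wp_regular [set cos 1]%SET.
  congr BDC; apply/seteqP; split=> w /=; rewrite inE;
    last by case=> /eqP.
  move/eqP=> wE; split=> //; rewrite /word_problem /=.
  case: (gsm_out _ _ _ _) => [|[x b] u].
    by rewrite /word_val big_nil.
  by have := X0 x.
have [out outP] := outE _ _ predT (gen_predT _ _ fgen).
rewrite (word_problem_schreier cosP (fun q a => (outP q a).2)).
have := PCF_gsm_preimage (coset_step k cos) out [set cos 1]%SET (cos 1) fL.
by congr PCF; apply/seteqP; split=> w /=; rewrite inE => -[/eqP].
Qed.
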